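(* Let $N\in\mathbb{N}$ and let $\xi$ be a random variable taking values in $\{0,\dots,N-1\}$. Then $\xi$ is $\mathbb{Z}_N$-stable if and only if either $\xi$ is degenerate at the point $0$, or there exists a divisor $M$ of $N$ such that $\xi$ has the same distribution as $M\cdot U$, where $U$ is a random variable uniformly distributed on the set $[0:\tfrac{N}{M}]$.
   Context: Notation: for a positive integer $K$, $[0:K]=\{0,1,\dots,K-1\}$. Let $\chi=[0:N]=\{0,\dots,N-1\}$ with the operation $x\oplus y=(x+y)\,\%\,N$, where $\%\,N$ denotes the remainder of division by $N$. A random variable $\xi$ taking values in $\chi$ is called $\mathbb{Z}_N$-stable if $\xi_1\oplus\xi_2$ has the same distribution as $\xi$, where $\xi_1,\xi_2$ are independent copies of $\xi$. Divisors are positive divisors. *)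

(* Defs.v *)
From HB Require Import structures.
From mathcomp Require Import all_boot all_order all_algebra.
From mathcomp Require Import all_classical all_reals all_analysis.

Set Implicit Arguments.
Unset Strict Implicit.
Unset Printing Implicit Defensive.

Import Order.TTheory GRing.Theory Num.Theory.
Local Open Scope classical_set_scope.
Local Open Scope ereal_scope.

Definition independent_rv d d1 d2 (T : measurableType d)
    (T1 : measurableType d1) (T2 : measurableType d2) (R : realType)
    (P : probability T R) (X : {RV P >-> T1}) (Y : {RV P >-> T2}) : Prop :=
  forall (A : set T1) (B : set T2), measurable A -> measurable B ->
    P ((X @^-1` A) `&` (Y @^-1` B)) = P (X @^-1` A) * P (Y @^-1` B).

Section operations.
Context d (T : measurableType d) (R : realType) (P : probability T R).

Definition oplus (N : nat) (X Y : {RV P >-> nat}) : T -> nat :=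
  fun t => ((X t + Y t) %% N)%N.

Lemma measurable_oplus (N : nat) (X Y : {RV P >-> nat}) :
  measurable_fun setT (oplus N X Y).
Proof.
move=> _ A _; rewrite setTI.
have -> : oplus N X Y @^-1` A =
    \bigcup_i \bigcup_j (if `[< A ((i + j) %% N)%N >]
      then (X @^-1` [set i]) `&` (Y @^-1` [set j]) else set0).
  apply/seteqP; split => [t At | t [i _ [j _]]].
    by exists (X t) => //; exists (Y t) => //; case: asboolP.
  by case: asboolP => // Aij [/= Xi Yj]; rewrite /oplus Xi Yj.
apply: bigcupT_measurable => i; apply: bigcupT_measurable => j.
case: ifP => // _; apply: measurableI.
  by rewrite -[X in measurable X]setTI; exact: measurable_funPT.
by rewrite -[X in measurable X]setTI; exact: measurable_funPT.
Qed.

HB.instance Definition _ (N : nat) (X Y : {RV P >-> nat}) :=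
  isMeasurableFun.Build _ _ _ _ (oplus N X Y) (measurable_oplus N X Y).

Definition scale (M : nat) (U : {RV P >-> nat}) : T -> nat :=
  fun t => (M * U t)%N.

Lemma measurable_scale (M : nat) (U : {RV P >-> nat}) :
  measurable_fun setT (scale M U).
Proof.
by move=> _ A _; apply: (@measurable_funPT _ _ _ _ U _
  [set u | A (M * u)%N]).
Qed.

HB.instance Definition _ (M : nat) (U : {RV P >-> nat}) :=
  isMeasurableFun.Build _ _ _ _ (scale M U) (measurable_scale M U).

Definition degenerate_at (a : nat) (X : {RV P >-> nat}) : Prop :=
  distribution P X [set a] = 1.

Definition uniform_on (n : nat) (U : {RV P >-> nat}) : Prop :=
  forall k : nat,
    distribution P U [set k] = (if (k < n)%N then (n%:R^-1)%R else 0%R)%:E.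

End operations.

(* The independent copies may live on any probability space, in particular on
   the product of P with itself, where they always exist; the condition only
   depends on the distribution of X. *)
Definition ZN_stable (N : nat) d (T : measurableType d) (R : realType)
    (P : probability T R) (X : {RV P >-> nat}) : Prop :=
  forall d' (T' : measurableType d') (Q : probability T' R)
    (X1 X2 : {RV Q >-> nat}),
    independent_rv X1 X2 ->
    distribution Q X1 = distribution P X ->
    distribution Q X2 = distribution P X ->
    distribution Q (oplus N X1 X2) = distribution P X.

(* Main.v *)
Require Import Defs.
From HB Require Import structures.
From mathcomp Require Import all_boot all_order all_algebra.
From mathcomp Require Import all_classical all_reals all_analysis.

Import Order.TTheory GRing.Theory Num.Theory.
Set Implicit Arguments.
Unset Strict Implicit.
Unset Printing Implicit Defensive.

(** Let q be the law of xi, seen as an N-periodic function on the naturals.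
Stability means that q is idempotent for convolution on the cyclic group Z_N
([ZN_stableP]); this uses that the law of the sum of two independent variables
is the convolution of their laws, and that the product space carries two
independent copies of xi.

The idempotents are found by a maximum principle ([idem_subgroup_uniform]).
If q is maximal at x, then q x is the average of the values q (x - y) with
weights q y, so q (x - y) is maximal for every y in the support of q.  Taking
x = y at a maximum shows that q is maximal at 0; then q is maximal at - y for
every y in the support, hence, applying this twice, at y itself.  So q is
constant on its support, and its support is closed under subtraction: it is a
subgroup of Z_N, that is, the set of multiples of a divisor M of N, and q takes
there the value 1 / (N / M) because it has total mass 1.  Conversely, such a q
is clearly idempotent ([subgroup_uniform_idem]).

It remains to recognize this law as that of M * U, where U is xi divided by M;
degeneracy at 0 is the case M = N. *)

(** * Idempotent probability laws on a cyclic group *)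

Section idem.
Local Open Scope ring_scope.
Variables (R : realFieldType) (N : nat) (q : nat -> R).

(** The convolution square of q on Z_N, for q periodic of period N; the argument
n + (N - i) stands for the residue of n - i. *)
Definition cyclic_conv (n : nat) : R :=
  \sum_(i < N) q i * q (n + (N - i))%N.

(** The uniform law on the subgroup of multiples of M in Z_N, for M a divisor of
N, extended N-periodically to the naturals. *)
Definition subgroup_uniform (M : nat) (n : nat) : R :=
  if (M %| n)%N then (N %/ M)%:R^-1 else 0.

Lemma sum_dvdn_ord (M : nat) (c : R) : (0 < N)%N -> (M %| N)%N ->
  \sum_(i < N) (if (M %| i)%N then c else 0) = c *+ (N %/ M).
Proof.
move=> N0 MN; have M0 := dvdn_gt0 N0 MN; case/dvdnP: MN => k Nk.
rewrite Nk mulnK // -(big_mkord xpredT (fun i => if (M %| i)%N then c else 0)).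
elim: k {Nk} => [|k IH]; first by rewrite mul0n big_geq.
rewrite mulSnr (@big_cat_nat _ _ _ (k * M)%N) ?leq_addr //= IH.
rewrite mulrSr; congr (_ + _).
rewrite -{1}[(k * M)%N]add0n big_addn addKn.
rewrite big_ltn // add0n dvdn_mull // big_nat big1 ?addr0 // => i /andP[i0 iM].
by rewrite dvdn_addl ?dvdn_mull // gtnNdvd.
Qed.

Hypotheses (N_gt0 : (0 < N)%N) (q_ge0 : forall n, 0 <= q n).
Hypotheses (q_sum : \sum_(i < N) q i = 1).
Hypotheses (q_per : forall n, q (n + N)%N = q n).

Lemma subgroup_uniform_idem M : (M %| N)%N -> q =1 subgroup_uniform M ->
  q =1 cyclic_conv.
Proof.
move=> MN qE n; rewrite /cyclic_conv -[LHS]mul1r -q_sum mulr_suml.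
apply: eq_bigr => i _; rewrite qE.
rewrite /subgroup_uniform; case: ifP => [Mi|]; last by rewrite !mul0r.
by rewrite !qE /subgroup_uniform dvdn_addl // dvdn_subr // ltnW.
Qed.

Lemma periodic_mul k n : q (n + k * N)%N = q n.
Proof. by elim: k => [|k IH]; rewrite ?addn0 // mulSnr addnA q_per. Qed.

Lemma periodic_modn n : q (n %% N) = q n.
Proof. by rewrite {2}(divn_eq n N) addnC periodic_mul. Qed.

(** Every idempotent law on Z_N is uniform on a subgroup. *)
Lemma idem_subgroup_uniform : q =1 cyclic_conv ->
  exists2 M, (M %| N)%N & q =1 subgroup_uniform M.
Proof.
move=> qC.
have [m qm] : exists m, forall n, q n <= q m.
  have [m _ qm] := Order.TotalTheory.arg_maxP (fun i : 'I_N => q i)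
    (isT : xpredT (Ordinal N_gt0)).
  exists m => n; rewrite -periodic_modn.
  exact: (qm (Ordinal (ltn_pmod n N_gt0))).
have qm_gt0 : 0 < q m.
  rewrite lt_def q_ge0 andbT; apply/eqP => qm0; move: q_sum.
  rewrite big1 => [/eqP|i _]; first by rewrite eq_sym oner_eq0.
  by apply/le_anti; rewrite q_ge0 -qm0 qm.
(* A maximal value that is a weighted average of values of q forces all the
   values of positive weight to be maximal. *)
have max_shift x y : q x = q m -> (y < N)%N -> 0 < q y ->
    q (x + (N - y))%N = q m.
  move=> qx yN qy; apply/eqP; move: (qC x) => /eqP.
  rewrite qx -[eqbLHS]mul1r -q_sum mulr_suml -subr_eq0 -sumrB psumr_eq0.
    move/allP/(_ (Ordinal yN)); rewrite mem_index_enum => /(_ isT) /=.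
    by rewrite -mulrBr mulf_eq0 gt_eqF //= subr_eq0 eq_sym.
  by move=> i _; rewrite -mulrBr mulr_ge0 ?subr_ge0.
have max_sub x y : q x = q m -> 0 < q y ->
    exists2 z, (z + y = x %[mod N])%N & q z = q m.
  move=> qx qy; have yN := ltn_pmod y N_gt0.
  exists (x + (N - y %% N))%N; last by rewrite max_shift // periodic_modn.
  by rewrite -modnDmr -addnA subnK ?(ltnW yN) // modnDr.
have q_mod x y : (x = y %[mod N])%N -> q x = q y.
  by move=> xy; rewrite -periodic_modn xy periodic_modn.
have q0 : q 0%N = q m.
  have [z zm qz] := max_sub m m erefl qm_gt0.
  rewrite -qz; apply: q_mod; apply/eqP.
  by rewrite -(eqn_modDr m) add0n eq_sym; apply/eqP.
(* From y in the support, q is maximal at - y, hence at - (- y). *)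
have supp_const y : 0 < q y -> q y = q m.
  move=> qy; have [z zy qz] := max_sub 0%N y q0 qy.
  have [|w wz qw] := max_sub 0%N z q0; first by rewrite qz.
  rewrite -qw; apply: q_mod; apply/eqP.
  by rewrite -(eqn_modDr z) addnC zy wz.
have supp_sub x y : 0 < q (x + y)%N -> 0 < q y -> 0 < q x.
  move=> qxy qy; have [z zxy qz] := max_sub _ _ (supp_const _ qxy) qy.
  suff -> : q x = q z by rewrite qz.
  by apply: q_mod; apply/eqP; rewrite -(eqn_modDr y) zxy.
have supp_mod x y : 0 < q x -> 0 < q y -> 0 < q (x %% y)%N.
  move=> qx qy; move: qx; rewrite {1}(divn_eq x y).
  elim: (x %/ y)%N => [|k IH]; first by rewrite mul0n.
  by rewrite mulSnr -addnA [(y + _)%N]addnC addnA => /supp_sub /(_ qy).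
have qN : 0 < q N by rewrite -[N]add0n q_per q0.
have [M /andP[M_gt0 qM] Mmin] := @ex_minnP (fun k => (0 < k)%N && (0 < q k))
  (ex_intro _ N (introT andP (conj N_gt0 qN))).
have supp_dvd n : 0 < q n -> (M %| n)%N.
  move=> qn; rewrite /dvdn eqn0Ngt; apply/negP => r_gt0.
  have := Mmin (n %% M)%N; rewrite r_gt0 supp_mod //= leqNgt ltn_pmod //.
  by move=> /(_ isT).
(* k * M is obtained from k * M * N, a multiple of N, by subtracting M
   repeatedly. *)
have supp_mul k : 0 < q (k * M)%N.
  have: 0 < q (k * M * N)%N by rewrite -[(_ * N)%N]add0n periodic_mul q0.
  suff H j : 0 < q (k * M + j * M)%N -> 0 < q (k * M)%N.
    move=> h; apply: (H (k * N.-1)%N).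
    suff -> : (k * M + k * N.-1 * M = k * M * N)%N by [].
    by rewrite -mulnDl -{1}[k]muln1 -mulnDr add1n prednK // mulnAC.
  elim: j => [|j IH]; first by rewrite addn0.
  by rewrite mulSnr addnA => /supp_sub /(_ qM).
have MN := supp_dvd _ qN.
have qE n : q n = if (M %| n)%N then q m else 0.
  case: ifP => [/dvdnP[k ->]|nM]; first exact/supp_const/supp_mul.
  apply/eqP; rewrite eq_le q_ge0 andbT leNgt.
  by apply/negP => /supp_dvd; rewrite nM.
exists M => // n; rewrite qE /subgroup_uniform; case: ifP => // _.
move: q_sum; under eq_bigr do rewrite qE.
rewrite sum_dvdn_ord // -(mulr_natr (q m)) => qmNM.
have NM0 : (N %/ M)%:R != 0 :> R.
  by apply/eqP => e; move: qmNM; rewrite e mulr0 => /esym/eqP; rewrite oner_eq0.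
by apply: (mulIf NM0); rewrite qmNM mulVf.
Qed.

End idem.

(** * Measures on the natural numbers *)

Section countable_laws.
Local Open Scope classical_set_scope.
Local Open Scope ereal_scope.
Variable R : realType.
Implicit Types mu nu : measure nat R.

Lemma measure_natE mu (A : set nat) :
  mu A = \sum_(0 <= i <oo | i \in A) mu [set i].
Proof.
rewrite -measure_bigcup//; first by rewrite bigcup_imset1 image_id.
by move=> i j _ _ [x [-> ->]].
Qed.

Lemma eq_measure_nat mu nu : (forall k, mu [set k] = nu [set k]) ->
  mu = nu :> (set nat -> \bar R).
Proof.
move=> munu; apply/funext => A; rewrite !measure_natE.
by apply: eq_eseriesr => i _.
Qed.

Lemma measure_nat_eq0 mu (A : set nat) : (forall k, A k -> mu [set k] = 0) ->
  mu A = 0.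
Proof.
by move=> mu0; rewrite measure_natE eseries0 // => i _ /set_mem /mu0.
Qed.

End countable_laws.

(** * Laws of integer random variables modulo N *)

Section random_variables.
Local Open Scope classical_set_scope.
Local Open Scope ereal_scope.
Context d (T : measurableType d) (R : realType) (P : probability T R).
Implicit Types X : {RV P >-> nat}.

Lemma measurable_preimage X (A : set nat) : measurable (X @^-1` A).
Proof. by rewrite -[X in measurable X]setTI; exact: measurable_funPT. Qed.

(** The set of naturals congruent to n modulo N. *)
Definition residue_class (N n : nat) : set nat := [set x | (x = n %[mod N])%N].

(** The probability that X is congruent to n modulo N.  Working with residues
makes the convolution formula below hold for all independent variables, whether
bounded by N or not. *)
Definition residue_pmf (N : nat) X (n : nat) : R :=
  fine (distribution P X (residue_class N n)).

Lemma EFin_residue_pmf N X n :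
  (residue_pmf N X n)%:E = distribution P X (residue_class N n).
Proof. by rewrite fineK //; apply: fin_num_measure. Qed.

Lemma residue_pmf_ge0 N X n : (0 <= residue_pmf N X n)%R.
Proof. exact/fine_ge0/measure_ge0. Qed.

Lemma residue_pmf_periodic N X n :
  residue_pmf N X (n + N) = residue_pmf N X n.
Proof. by rewrite /residue_pmf /residue_class modnDr. Qed.

Lemma measure_residue_partition N X (A : set T) : (0 < N)%N -> measurable A ->
  P A = \sum_(i < N) P (A `&` X @^-1` residue_class N i).
Proof.
move=> N0 mA; pose F i := A `&` X @^-1` residue_class N i.
have mF i : measurable (F i).
  by apply: measurableI => //; exact: measurable_preimage.
rewrite -(@measure_semi_additive_ord_I _ _ _ P F) //.
- congr (P _); rewrite -bigcup_mkord.
  apply/seteqP; split => [t At|t [i _ []//]].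
  exists (X t %% N)%N; first exact: ltn_pmod.
  by split => //; rewrite /residue_class /= modn_mod.
- move=> i j /= iN jN [t [[_ +] [_]]]; rewrite /residue_class /= => ->.
  by rewrite !modn_small.
- by apply: bigsetU_measurable => i _.
Qed.

Lemma residue_pmf_sum N X : (0 < N)%N -> (\sum_(i < N) residue_pmf N X i = 1)%R.
Proof.
move=> N0; apply: EFin_inj; rewrite -sumEFin.
rewrite -(probability_setT P) (measure_residue_partition X N0) //.
by apply: eq_bigr => i _; rewrite EFin_residue_pmf setTI.
Qed.

Lemma residue_pmf_oplus N (X Y : {RV P >-> nat}) n : (0 < N)%N ->
  independent_rv X Y ->
  residue_pmf N (oplus N X Y) n =
  (\sum_(i < N) residue_pmf N X i * residue_pmf N Y (n + (N - i)))%R.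
Proof.
move=> N0 XY; apply: EFin_inj; rewrite EFin_residue_pmf -sumEFin.
rewrite /distribution /pushforward (measure_residue_partition X N0); last first.
  exact: measurable_preimage.
apply: eq_bigr => i _; rewrite EFinM !EFin_residue_pmf -XY //; congr (P _).
have iN := ltn_ord i.
apply/seteqP; split => t; rewrite /residue_class /oplus /= modn_mod => -[];
  last first.
  move=> Xi Yi; split => //; apply/eqP; rewrite -modnDm Xi Yi modnDm.
  by rewrite addnCA subnKC ?modnDr // ltnW.
move=> XYn Xi; split => //; apply/eqP; rewrite -(eqn_modDl (X t)) XYn.
by rewrite -[eqbRHS]modnDml Xi modnDml addnCA subnKC ?modnDr // ltnW.
Qed.

Lemma distribution_set1 N X k : (forall t, (X t < N)%N) ->
  distribution P X [set k] = (if (k < N)%N then residue_pmf N X k else 0%R)%:E.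
Proof.
move=> XN; rewrite /distribution /pushforward; case: ltnP => kN.
  rewrite EFin_residue_pmf; congr (P _); apply/seteqP; split => t /=.
    by rewrite /residue_class /= => ->.
  by rewrite /residue_class /= !modn_small.
rewrite [X in P X](_ : _ = set0) ?measure0 // -subset0 => t /= tk.
by have := XN t; rewrite tk ltnNge kN.
Qed.

(** The integer quotient of X by M. *)
Definition quotient_rv (M : nat) X : T -> nat := fun t => (X t %/ M)%N.

Lemma measurable_quotient_rv M X : measurable_fun setT (quotient_rv M X).
Proof.
by move=> _ A _; apply: (@measurable_funPT _ _ _ _ X _ [set x | A (x %/ M)%N]).
Qed.

HB.instance Definition _ (M : nat) X :=
  isMeasurableFun.Build _ _ _ _ (quotient_rv M X) (measurable_quotient_rv M X).

Lemma distribution_scale_uniform N M (U : {RV P >-> nat}) k :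
  (0 < N)%N -> (M %| N)%N -> uniform_on (N %/ M) U ->
  distribution P (scale M U) [set k] =
  (if (k < N)%N then subgroup_uniform R N M k else 0%R)%:E.
Proof.
move=> N0 MN unifU; have M0 : (0 < M)%N by exact: dvdn_gt0 MN.
rewrite /subgroup_uniform; case: (boolP (M %| k)%N) => [/dvdnP[j ->]|Mk].
  rewrite -ltn_divRL // -unifU; congr (P _); apply/seteqP; split => t /=.
    by rewrite /scale mulnC => /eqP; rewrite eqn_pmul2r // => /eqP.
  by rewrite /scale mulnC => ->.
rewrite if_same /distribution /pushforward.
rewrite [X in P X](_ : _ = set0) ?measure0 // -subset0 => t /= tk.
by move: Mk; rewrite -tk /scale dvdn_mulr.
Qed.

(** If X is uniform on the multiples of M below N, then X is almost surely, but
not necessarily everywhere, a multiple of M; so the event that the quotient is k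
differs from the event X = k * M by a null set. *)
Lemma uniform_quotient_rv N M X : (0 < N)%N -> (M %| N)%N ->
  (forall k, distribution P X [set k] =
    (if (k < N)%N then subgroup_uniform R N M k else 0%R)%:E) ->
  @uniform_on _ _ _ P (N %/ M) (quotient_rv M X).
Proof.
move=> N0 MN XE k; have M0 : (0 < M)%N by exact: dvdn_gt0 MN.
have -> : distribution P (quotient_rv M X) [set k] =
    distribution P X ([set (k * M)%N] `|`
      [set x | (x %/ M)%N = k /\ x <> (k * M)%N]).
  congr (P _); apply/seteqP; split => t /=; rewrite /quotient_rv.
    move=> tk; have [|/eqP] := eqVneq (X t) (k * M)%N; first by left.
    by right.
  by case=> [->|[]//]; rewrite mulnK.
rewrite measureU0 //; last first.
  apply: measure_nat_eq0 => x [xk xkM].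
  apply: etrans (XE x) _; rewrite /subgroup_uniform.
  case: ifP => // _; case: ifP => // /dvdnP[j xj]; case: xkM.
  by rewrite -xk xj mulnK.
by apply: etrans (XE _) _; rewrite /subgroup_uniform dvdn_mull // ltn_divRL.
Qed.

Lemma degenerate_at_set1 a X k : degenerate_at a X ->
  distribution P X [set k] = (if k == a then 1%R else 0%R)%:E.
Proof.
move=> Xa; have [->//|ka] := eqVneq k a.
apply/eqP; rewrite eq_le measure_ge0 andbT.
apply: (@le_trans _ _ (distribution P X (~` [set a]))).
  by apply: le_measure; rewrite ?inE // => x /= ->; apply/eqP.
by rewrite probability_setC // [X in 1 - X]Xa subee.
Qed.

End random_variables.

Lemma eq_residue_pmf (R : realType) N d (T : measurableType d)
    (P : probability T R) d' (T' : measurableType d') (Q : probability T' R)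
    (X : {RV P >-> nat}) (Y : {RV Q >-> nat}) :
  distribution P X = distribution Q Y -> residue_pmf N X =1 residue_pmf N Y.
Proof. by move=> XY n; rewrite /residue_pmf XY. Qed.

(** * Independent copies and stability *)

Section independent_copies.
Local Open Scope classical_set_scope.
Local Open Scope ereal_scope.
Context d (T : measurableType d) (R : realType) (P : probability T R).
Variable X : {RV P >-> nat}.

(** The two coordinates on the product space T * T, composed with X: independent
copies of X under the product probability. *)
Definition copy1 : T * T -> nat := X \o fst.
Definition copy2 : T * T -> nat := X \o snd.

Lemma measurable_copy1 : measurable_fun setT copy1.
Proof. exact: measurableT_comp. Qed.

Lemma measurable_copy2 : measurable_fun setT copy2.
Proof. exact: measurableT_comp. Qed.

HB.instance Definition _ :=
  isMeasurableFun.Build _ _ _ _ copy1 measurable_copy1.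
HB.instance Definition _ :=
  isMeasurableFun.Build _ _ _ _ copy2 measurable_copy2.

Lemma product_copiesE (A B : set nat) :
  (P \x P) (copy1 @^-1` A `&` copy2 @^-1` B) = P (X @^-1` A) * P (X @^-1` B).
Proof.
by rewrite -product_measure1E //; exact: measurable_preimage.
Qed.

Lemma distribution_copy1 : distribution (P \x P) copy1 = distribution P X.
Proof.
apply/funext => A; have := product_copiesE A setT.
by rewrite !preimage_setT setIT probability_setT mule1.
Qed.

Lemma distribution_copy2 : distribution (P \x P) copy2 = distribution P X.
Proof.
apply/funext => A; have := product_copiesE setT A.
by rewrite !preimage_setT setTI probability_setT mul1e.
Qed.

Lemma independent_copies :
  @independent_rv _ _ _ _ _ _ _ (P \x P)%E copy1 copy2.
Proof.
move=> A B _ _; apply: etrans (product_copiesE A B) _.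
by rewrite -[P (X @^-1` A)]/(distribution P X A)
  -[P (X @^-1` B)]/(distribution P X B)
  -{1}distribution_copy1 -distribution_copy2.
Qed.

End independent_copies.

(** For a variable with values below N, stability is idempotence of its law
under cyclic convolution. *)
Lemma ZN_stableP N d (T : measurableType d) (R : realType)
    (P : probability T R) (X : {RV P >-> nat}) :
  (0 < N)%N -> (forall t, (X t < N)%N) ->
  ZN_stable N X <-> residue_pmf N X =1 cyclic_conv N (residue_pmf N X).
Proof.
move=> N0 XN; split => [stX n|idX d' T' Q X1 X2 indX X1X X2X].
  rewrite -(eq_residue_pmf _ (stX _ _ _ _ _ (independent_copies X)
    (distribution_copy1 X) (distribution_copy2 X))).
  rewrite residue_pmf_oplus //; last exact: independent_copies.
  apply: eq_bigr => i _.
  by rewrite (eq_residue_pmf _ (distribution_copy1 X))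
             (eq_residue_pmf _ (distribution_copy2 X)).
have oplusN t : (oplus N X1 X2 t < N)%N by exact: ltn_pmod.
apply: eq_measure_nat => k.
apply: etrans (distribution_set1 k oplusN) _.
apply: etrans (esym (distribution_set1 k XN)).
congr (if _ then _ else _)%:E; rewrite residue_pmf_oplus // idX.
apply: eq_bigr => i _.
by rewrite (eq_residue_pmf _ X1X) (eq_residue_pmf _ X2X).
Qed.

Theorem theorem4 (N : nat) (hN : (0 < N)%N) (R : realType)
    (d : measure_display) (T : measurableType d) (P : probability T R)
    (xi : {RV P >-> nat}) (hxi : forall t : T, (xi t < N)%N) :
  ZN_stable N xi <->
  (degenerate_at 0 xi \/
   exists M : nat, (M %| N)%N /\
     exists (d' : measure_display) (T' : measurableType d')
            (Q : probability T' R) (U : {RV Q >-> nat}),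
       uniform_on (N %/ M) U /\
       distribution P xi = distribution Q (scale M U)).
Proof.
rewrite ZN_stableP //; split => [idxi|H].
  have [M MN xiE] := idem_subgroup_uniform hN (residue_pmf_ge0 N xi)
    (residue_pmf_sum xi hN) (residue_pmf_periodic N xi) idxi.
  have xi1 k : distribution P xi [set k]%classic =
      (if (k < N)%N then subgroup_uniform R N M k else 0%R)%:E.
    by rewrite (distribution_set1 _ hxi) xiE.
  have unif := uniform_quotient_rv hN MN xi1.
  right; exists M; split => //.
  exists d, T, P, (quotient_rv M xi); split => //.
  apply: eq_measure_nat => k.
  by rewrite [LHS]xi1; exact/esym/distribution_scale_uniform.
have [M MN xi1] : exists2 M, (M %| N)%N & forall k,
    distribution P xi [set k]%classic =
    (if (k < N)%N then subgroup_uniform R N M k else 0%R)%:E.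
  case: H => [xi0|[M [MN [d' [T' [Q [U [unif ->]]]]]]]]; last first.
    by exists M => // k; exact: distribution_scale_uniform.
  (* The uniform law on the multiples of N below N is the point mass at 0. *)
  exists N => // k; rewrite (degenerate_at_set1 _ xi0) /subgroup_uniform.
  case: ltnP => kN; last by case: eqP kN => // ->; rewrite leqNgt hN.
  rewrite divnn hN invr1; case: (posnP k) => [->|k0]; first by rewrite dvdn0.
  by rewrite gtnNdvd.
apply: (subgroup_uniform_idem (residue_pmf_sum xi hN) MN) => k.
have := xi1 (k %% N)%N; rewrite (distribution_set1 _ hxi) ltn_pmod // => -[].
rewrite (periodic_modn (residue_pmf_periodic N xi)).
by rewrite /subgroup_uniform /dvdn modn_dvdm.
Qed.
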